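(* Let $f,g:\mathbb{N}\to\mathbb{C}$ be essentially bounded arithmetic functions. Let $x$ range over positive integers, and let $h=h(x)$, $H=H(x)$ be positive integers with $h\le H$ and $H=o(x)$ as $x\to\infty$. Then for every $\varepsilon>0$, as $x\to\infty$, $$\sum_{1\le a\le H}\ \sum_{x<n\le x+h}f(n)g(n-a)=\Big(\sum_{1\le a\le H}g(x-a)\Big)\Big(\sum_{x<n\le x+h}f(n)\Big)+O_{\varepsilon}\big(x^{\varepsilon}h^2\big).$$
   Context: An arithmetic function $f:\mathbb{N}\to\mathbb{C}$ is called essentially bounded if for every $\varepsilon>0$ one has $f(n)\ll_{\varepsilon} n^{\varepsilon}$ as $n\to\infty$. The notation $O_\varepsilon(\cdot)$ (and $\ll_\varepsilon$) means the implied constant may depend on $\varepsilon$ (and on the fixed functions $f,g$), but not on $x,h,H$. Since $H=o(x)$, the arguments $n-a$ and $x-a$ are positive integers for $x$ large. *)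

(* Defs.v *)
From mathcomp Require Import all_boot all_order all_algebra.
From mathcomp Require Import complex.
From mathcomp Require Import all_classical all_reals all_analysis.
Set Implicit Arguments.
Unset Strict Implicit.
Unset Printing Implicit Defensive.
Import Order.TTheory GRing.Theory Num.Theory.
Import numFieldNormedType.Exports.
Local Open Scope classical_set_scope.
Local Open Scope ring_scope.
Local Open Scope complex_scope.

(* An arithmetic function on the positive integers is encoded as a function on
   [nat]; its value at [0] is irrelevant. The comparison function [n ^ eps] is
   embedded in [R[i]] so that both sides of the library's big-O live in the same
   normed space. *)
Definition essentially_bounded (R : realType) (f : nat -> R[i]) : Prop :=
  forall eps : R, 0 < eps ->
    (f : nat -> R[i]^o) =O_\oo (fun n : nat => ((n%:R : R) `^ eps)%:C : R[i]^o).

(* Main.v *)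
(* Writing n = x + j with 1 <= j <= h, the sums of g over the windows
   [n - H, n) and [x - H, x) differ only in j terms at each end, all of them at
   integers between x/2 and 2x, so the difference is O(h x^(eps/2)). Multiplying
   by f n = O(x^(eps/2)) and summing over the h values of n gives the error. *)
Require Import Defs.
From mathcomp Require Import all_boot all_order all_algebra.
From mathcomp Require Import complex.
From mathcomp Require Import all_classical all_reals all_analysis.
From mathcomp Require Import zify ring.
Import Order.TTheory GRing.Theory Num.Theory.
Import numFieldNormedType.Exports.
Local Open Scope classical_set_scope.
Local Open Scope ring_scope.
Local Open Scope complex_scope.

(** Both windows come from the sum of [g (n - a)] over [0 <= a <= H], by dropping its last or its
    first term; truncated subtraction is therefore harmless when [H > n]. *)
Lemma sum_window_shift (V : zmodType) (g : nat -> V) (n H : nat) :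
  \sum_(1 <= a < H.+1) g (n.+1 - a)%N
  = \sum_(1 <= a < H.+1) g (n - a)%N + (g n - g (n - H)%N).
Proof.
have <- : \sum_(0 <= a < H) g (n - a)%N = \sum_(1 <= a < H.+1) g (n.+1 - a)%N.
  by rewrite big_add1 /=; apply: eq_bigr => a _; rewrite subSS.
rewrite [RHS]addrA; apply: (canRL (addrK _)).
by rewrite -(big_nat_recr H) //= big_ltn // subn0 addrC.
Qed.

(** Telescoping over [j] unit shifts: the one from [x + i] costs two values of [g], at [x + i] and
    [x + i - H]. *)
Lemma norm_window_diff (K : numDomainType) (V : normedZmodType K)
    (g : nat -> V) (x H j : nat) (B : K) :
  (forall k, (x - H <= k < x + j)%N -> `|g k| <= B) ->
  `|\sum_(1 <= a < H.+1) g (x + j - a)%N - \sum_(1 <= a < H.+1) g (x - a)%N|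
  <= B *+ (2 * j).
Proof.
elim: j => [|j IHj] leB; first by rewrite addn0 subrr normr0.
rewrite addnS sum_window_shift addrAC mulnS [(2 + _)%N]addnC mulrnDr.
apply: le_trans (ler_normD _ _) _; apply: lerD.
  by apply: IHj => k kP; apply: leB; lia.
rewrite mulr2n; apply: le_trans (ler_normB _ _) _.
by apply: lerD; apply: leB; lia.
Qed.

Lemma norm_shifted_convolution (K : numDomainType) (f g : nat -> K)
    (x h H : nat) (A B : K) :
  (forall n, (x < n <= x + h)%N -> `|f n| <= A) ->
  (forall k, (x - H <= k < x + h)%N -> `|g k| <= B) ->
  `| \sum_(1 <= a < H.+1) \sum_(x.+1 <= n < (x + h).+1) f n * g (n - a)%N
     - (\sum_(1 <= a < H.+1) g (x - a)%N)
       * (\sum_(x.+1 <= n < (x + h).+1) f n) |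
  <= 2 * A * B * h%:R ^+ 2.
Proof.
move=> leA leB.
(* With [n] outermost, [f n] factors out of a difference of two windows of [g]. *)
rewrite exchange_big mulr_sumr -sumrB /=.
have -> : 2 * A * B * h%:R ^+ 2
    = \sum_(x.+1 <= n < (x + h).+1) A * (B *+ (2 * h)).
  rewrite sumr_const_nat subSS addKn -mulr_natr -[B *+ _]mulr_natr natrM; ring.
apply: le_trans (ler_norm_sum _ _ _) _.
apply: ler_sum_nat => n nP.
rewrite -mulr_sumr [X in _ - X]mulrC -mulrBr normrM.
apply: ler_pM => //; first by apply: leA; lia.
(* The index [x] lies in the range of [leB], since the existence of [n] forces [0 < h]. *)
have B0 : 0 <= B by apply: le_trans (normr_ge0 (g x)) (leB _ _); lia.
have -> : n = (x + (n - x))%N by lia.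
apply: (@le_trans _ _ (B *+ (2 * (n - x)))).
  by apply: norm_window_diff => k kP; apply: leB; lia.
by apply: ler_wpMn2l => //; lia.
Qed.

Lemma essentially_bounded_le {R : realType} {f : nat -> R[i]} (eps : R) :
  essentially_bounded f -> 0 < eps ->
  exists2 C : R, 0 <= C &
    \forall n \near \oo, `|f n| <= (C * n%:R `^ eps)%:C.
Proof.
move=> hf /hf /eqO_exP[k k0 kP].
(* The big-O constant is a positive element of [R[i]], hence real. *)
have kE : k = (complex.Re k)%:C by rewrite RRe_real // gtr0_real.
exists (complex.Re k); first by rewrite -lecR -kE ltW.
apply: filterS kP => n; rewrite rmorphM /= -kE.
by rewrite (ger0_norm (_ : 0 <= (_ `^ _)%:C)) // lecR powR_ge0.
Qed.

Theorem theorem0 (R : realType) (f g : nat -> R[i])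
    (hf : essentially_bounded f) (hg : essentially_bounded g)
    (eps : R) (heps : 0 < eps) :
  exists C : R, forall h H : nat -> nat,
    (forall x : nat, (0 < x)%N -> (0 < h x)%N /\ (h x <= H x)%N) ->
    (fun x : nat => (H x)%:R : R^o) =o_\oo (fun x : nat => x%:R : R^o) ->
    \forall x \near \oo,
      `| \sum_(1 <= a < (H x).+1) \sum_(x.+1 <= n < (x + h x).+1)
           f n * g (n - a)%N
         - (\sum_(1 <= a < (H x).+1) g (x - a)%N)
           * (\sum_(x.+1 <= n < (x + h x).+1) f n) |
      <= (C * (x%:R `^ eps * (h x)%:R ^+ 2))%:C.
Proof.
have e0 : 0 < eps / 2 by rewrite divr_gt0.
have [A A0 [N _ fA]] := essentially_bounded_le _ hf e0.
have [B B0 [M _ gB]] := essentially_bounded_le _ hg e0.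
(* The factor [2 ^ eps] is the cost of replacing every argument by [2 * x] in both bounds. Only the
   threshold for [x] depends on [H]. *)
exists (2 * A * B * 2 `^ eps) => h H hH /eqoP Ho.
near=> x.
have x0 : (0 < x)%N by near: x; exact: nbhs_infty_gt.
have xN : (2 * N <= x)%N by near: x; exact: nbhs_infty_ge.
have xM : (2 * M <= x)%N by near: x; exact: nbhs_infty_ge.
(* With [h x <= H x], this keeps all arguments of [f] and [g] between [x / 2] and [2 * x], so above
   [N] and [M] respectively. *)
have Hx : (2 * H x <= x)%N.
  have : `|(H x)%:R : R^o| <= 2^-1 * `|x%:R : R^o|.
    by near: x; apply: Ho; rewrite invr_gt0.
  rewrite !ger0_norm // ler_pdivlMl // => le2.
  by rewrite -(ler_nat R) natrM.
have [_ hHx] := hH x x0.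
set P := (2 * x%:R) `^ (eps / 2).
have mono (D : R) k : 0 <= D -> (k <= 2 * x)%N ->
    (D * k%:R `^ (eps / 2))%:C <= (D * P)%:C.
  move=> D0 kx; rewrite /P -natrM lecR ler_wpM2l // ge0_ler_powR ?nnegrE ?ler0n ?ler_nat //.
  exact: ltW.
have := @norm_shifted_convolution _ f g x (h x) (H x)
  (A * P)%:C (B * P)%:C.
move=> /(_ _ _)/le_trans; apply.
- move=> n nP; apply: le_trans (mono _ n A0 _); last by lia.
  by apply: fA => /=; lia.
- move=> k kP; apply: le_trans (mono _ k B0 _); last by lia.
  by apply: gB => /=; lia.
have powE : 2 `^ eps * x%:R `^ eps = P * P :> R.
  rewrite /P -powRM // -powRD; first by rewrite -splitr.
  by apply/implyP => _; rewrite mulf_neq0 // pnatr_eq0 -lt0n.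
(* Once both sides are read in [R], they are equal. *)
rewrite -(rmorph_nat (real_complex R) 2) -(rmorph_nat (real_complex R) (h x)).
rewrite -rmorphXn -!rmorphM lecR le_eqVlt; apply/orP; left; apply/eqP.
transitivity (2 * A * B * (2 `^ eps * x%:R `^ eps) * (h x)%:R ^+ 2).
  by rewrite powE; ring.
ring.
Unshelve. all: by end_near. Qed.
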